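(* Every satisfiable HyperLTL sentence has a countable model (i.e., is satisfied by some countable set of traces).
   Context: Fix a finite set $AP$ of atomic propositions. A trace over $AP$ is a map $t:\mathbb{N}\to 2^{AP}$. HyperLTL formulas are given by the grammar $\varphi ::= \exists \pi.\ \varphi \mid \forall \pi.\ \varphi \mid \psi$ and $\psi ::= a_\pi \mid \neg\psi \mid \psi\vee\psi \mid \mathbf{X}\psi \mid \psi\,\mathbf{U}\,\psi$, where $a\in AP$ and $\pi$ ranges over a countable set of trace variables. For a set $T$ of traces and a trace assignment $\Pi$ (a partial map from trace variables to traces), with $\Pi[j]$ denoting the assignment mapping each $\pi$ in the domain of $\Pi$ to the suffix $\Pi(\pi)(j)\Pi(\pi)(j+1)\cdots$: $(T,\Pi)\models a_\pi$ iff $a\in\Pi(\pi)(0)$; negation and disjunction are as usual; $(T,\Pi)\models\mathbf{X}\psi$ iff $(T,\Pi[1])\models\psi$; $(T,\Pi)\models\psi_1\mathbf{U}\psi_2$ iff there is $j\ge 0$ with $(T,\Pi[j])\models\psi_2$ and $(T,\Pi[j'])\models\psi_1$ for all $0\le j'<j$; $(T,\Pi)\models\exists\pi.\varphi$ iff there is $t\in T$ with $(T,\Pi[\pi\mapsto t])\models\varphi$; $(T,\Pi)\models\forall\pi.\varphi$ iff this holds for all $t\in T$. A sentence is a formula without free trace variables; $T$ satisfies (is a model of) a sentence $\varphi$ if $(T,\Pi_\emptyset)\models\varphi$ for the empty assignment $\Pi_\emptyset$. A sentence is satisfiable if it has a model. *)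

(* Defs.v *)
From mathcomp Require Import all_boot.
From mathcomp Require Import boolp classical_sets functions cardinality.

Set Implicit Arguments.
Unset Strict Implicit.
Unset Printing Implicit Defensive.

Definition trace (AP : finType) : Type := nat -> {set AP}.

Definition suffix_from (AP : finType) (j : nat) (t : trace AP) : trace AP :=
  fun i => t (j + i).

Inductive body (AP : finType) (V : countType) : Type :=
| Atom of AP & V
| Neg of body AP V
| Or of body AP V & body AP V
| Next of body AP V
| Until of body AP V & body AP V.

Inductive hyperltl (AP : finType) (V : countType) : Type :=
| Exists of V & hyperltl AP V
| Forall of V & hyperltl AP V
| Body of body AP V.

Fixpoint body_vars (AP : finType) (V : countType) (psi : body AP V) : seq V :=
  match psi with
  | Atom _ x => [:: x]
  | Neg p => body_vars p
  | Or p q => body_vars p ++ body_vars q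
  | Next p => body_vars p
  | Until p q => body_vars p ++ body_vars q
  end.

Fixpoint free_vars (AP : finType) (V : countType) (phi : hyperltl AP V) :
    seq V :=
  match phi with
  | Exists x p => [seq y <- free_vars p | y != x]
  | Forall x p => [seq y <- free_vars p | y != x]
  | Body psi => body_vars psi
  end.

Definition sentence (AP : finType) (V : countType) (phi : hyperltl AP V) :
    Prop :=
  free_vars phi = [::].

(* Partial maps: [None] means that the variable is outside the domain. *)
Definition assignment (AP : finType) (V : countType) : Type :=
  V -> option (trace AP).

Definition empty_assignment (AP : finType) (V : countType) : assignment AP V :=
  fun _ => None.

Definition update (AP : finType) (V : countType) (Pi : assignment AP V)
    (x : V) (t : trace AP) : assignment AP V :=
  fun y => if y == x then Some t else Pi y.

Definition shift (AP : finType) (V : countType) (Pi : assignment AP V)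
    (j : nat) : assignment AP V :=
  fun x => omap (suffix_from j) (Pi x).

(* An atom at a variable outside the domain of [Pi] is false; this convention
   is never exercised when a sentence is evaluated under the empty
   assignment. *)
Fixpoint body_sat (AP : finType) (V : countType) (T : set (trace AP))
    (Pi : assignment AP V) (psi : body AP V) : Prop :=
  match psi with
  | Atom a x => if Pi x is Some t then a \in t 0 else False
  | Neg p => ~ body_sat T Pi p
  | Or p q => body_sat T Pi p \/ body_sat T Pi q
  | Next p => body_sat T (shift Pi 1) p
  | Until p q =>
      exists j : nat,
        body_sat T (shift Pi j) q /\
        forall j' : nat, j' < j -> body_sat T (shift Pi j') p
  end.

Fixpoint sat (AP : finType) (V : countType) (T : set (trace AP))
    (Pi : assignment AP V) (phi : hyperltl AP V) : Prop :=
  match phi with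
  | Exists x p => exists t : trace AP, T t /\ sat T (update Pi x t) p
  | Forall x p => forall t : trace AP, T t -> sat T (update Pi x t) p
  | Body psi => body_sat T Pi psi
  end.

Definition is_model (AP : finType) (V : countType) (T : set (trace AP))
    (phi : hyperltl AP V) : Prop :=
  sat T (@empty_assignment AP V) phi.

Definition satisfiable (AP : finType) (V : countType) (phi : hyperltl AP V) :
    Prop :=
  exists T : set (trace AP), is_model T phi.

(* Main.v *)
(** The downward Löwenheim-Skolem argument: the value of a Skolem function at an
    existential quantifier depends only on the finite list of traces chosen for
    the quantifiers before it. All Skolem functions are therefore packed into a
    single function on finite lists of traces, and closing the empty set under
    it gives a countable submodel, enumerated by finite trees. *)

Require Import Defs.
From mathcomp Require Import all_boot.
From mathcomp Require Import boolp classical_sets functions cardinality.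

Set Implicit Arguments.
Unset Strict Implicit.
Unset Printing Implicit Defensive.

Local Open Scope classical_set_scope.

Section TreeEval.
Variables (X : Type) (g : seq X -> X).

Fixpoint tree_eval (s : GenTree.tree unit) : X :=
  match s with
  | GenTree.Leaf _ => g [::]
  | GenTree.Node _ ss => g (map tree_eval ss)
  end.

Lemma tree_eval_closed (ss : seq (GenTree.tree unit)) :
  range tree_eval (g (map tree_eval ss)).
Proof. by exists (GenTree.Node 0 ss). Qed.

Lemma range_tree_eval_sub : range tree_eval `<=` range g.
Proof.
by move=> _ [[u|n ss] _ <-] /=; [exists [::] | exists (map tree_eval ss)].
Qed.

Lemma countable_range_tree_eval : countable (range tree_eval).
Proof. by apply: (sub_countable (card_image_le _ _)); exact: countableP. Qed.

End TreeEval.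

Section Skolem.
Variables (AP : finType) (V : countType).
Implicit Types (T U : set (trace AP)) (Pi : assignment AP V).

(** Only quantifiers consult the set of traces, and a body has none. *)
Lemma body_sat_model T U Pi (psi : body AP V) :
  body_sat T Pi psi -> body_sat U Pi psi.
Proof.
(* An equality, unlike an implication, passes through [Neg] in the induction. *)
suff -> : body_sat T Pi psi = body_sat U Pi psi by [].
elim: psi Pi => [a x|p IH|p IHp q IHq|p IH|p IHp q IHq] Pi //=.
- by rewrite IH.
- by rewrite IHp IHq.
- by apply: eq_exists => j; rewrite IHq; under eq_forall do rewrite IHp.
Qed.

(* The list [l] instantiates the leading quantifiers of [phi]; the value is a
   witness for the quantifier that follows, and [t0] if there is none. *)
Fixpoint skolem T (t0 : trace AP) (phi : hyperltl AP V) Pi (l : seq (trace AP))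
    : trace AP :=
  match phi, l with
  | Exists x p, [::] => xget t0 [set t | T t /\ sat T (update Pi x t) p]
  | Exists x p, t :: l' | Forall x p, t :: l' =>
      skolem T t0 p (update Pi x t) l'
  | _, _ => t0
  end.

Lemma skolem_in T t0 phi Pi l : T t0 -> T (skolem T t0 phi Pi l).
Proof.
move=> Tt0; elim: phi Pi l => [x p IH|x p IH|psi] Pi [|t l] //=.
by case: xgetP => [t _ []|].
Qed.

(** Prefixing [e i] to the lists turns closure for a quantified formula into closure for the formula
    under its quantifier, at the updated assignment. *)
Lemma sat_skolem_closed (I : Type) (e : I -> trace AP) T t0 phi Pi :
  range e `<=` T ->
  (forall s : seq I, range e (skolem T t0 phi Pi (map e s))) ->
  sat T Pi phi -> sat (range e) Pi phi.
Proof.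
move=> eT; elim: phi Pi => [x p IH|x p IH|psi] Pi closed_e /=.
- move=> [t Tt]; have [i _ ei] := closed_e [::].
  exists (e i); split; first by exists i.
  apply: IH => [s|]; first exact: (closed_e (i :: s)).
  rewrite ei /=.
  by case: (xgetI t0 (P := [set u | T u /\ sat T (update Pi x u) p]) Tt).
- move=> satT _ [i _ <-]; apply: IH => [s|]; first exact: (closed_e (i :: s)).
  by apply: satT; apply: eT; exists i.
- exact: body_sat_model.
Qed.

End Skolem.

Theorem theorem2 (AP : finType) (V : countType) (phi : hyperltl AP V)
    (Hsentence : sentence phi) (Hsat : satisfiable phi) :
  exists T : set (trace AP), countable T /\ is_model T phi.
Proof.
have [T modT] := Hsat.
(* The default [t0] must lie in [T]; an empty [T] is itself countable. *)
have [T0|/set0P[t0 Tt0]] := eqVneq T set0.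
  by exists T; split=> //; rewrite T0; exact: countable0.
set g := skolem T t0 phi (@empty_assignment AP V).
exists (range (tree_eval g)); split; first exact: countable_range_tree_eval.
apply: sat_skolem_closed modT; last exact: tree_eval_closed.
by move=> t /(@range_tree_eval_sub _ g)[l _ <-]; exact: skolem_in.
Qed.
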